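(* Let $\Gamma=(V,E)$ be a star-free simple graph. Then there exists a monomial semigroup $S$ such that $\Gamma(S)=\Gamma$ (i.e. the commuting graph of $S$ is isomorphic to $\Gamma$). Moreover, if $\Gamma$ has $n$ vertices ($n$ finite), then there exists a monomial semigroup $S$ with $\Gamma(S)=\Gamma$ such that $S$ is generated by $n$ elements and its order is $n^{2}+n+1-|E|$.
   Context: For a semigroup $S$, $Z(S)$ denotes its center, i.e. the set of elements commuting with every element of $S$. The commuting graph $\Gamma(S)$ is the simple graph with vertex set $S\setminus Z(S)$ in which two distinct vertices are joined by an edge if and only if they commute in $S$. A vertex of a graph is called a star if it is adjacent to every other vertex of the graph (vacuously so for the only vertex of a one-vertex graph); a graph is star-free if none of its vertices is a star. Semigroups constructed here have a zero element $0$, and presentations and generation are understood in the category of semigroups with zero. A semigroup is monomial if it has a presentation all of whose relations are of the form $w=0$, with $w$ a word in the generators. *)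

(* Defs.v *)
From HB Require Import structures.
From mathcomp Require Import all_boot.
From mathcomp Require Import boolp classical_sets cardinality.

Set Implicit Arguments.
Unset Strict Implicit.
Unset Printing Implicit Defensive.

Local Open Scope group_scope.
Local Open Scope classical_set_scope.

(* Vertex sets may be infinite. *)
Record sgraph := SGraph {
  vertex :> Type;
  adj : vertex -> vertex -> Prop;
  adj_sym : forall u v, adj u v -> adj v u;
  adj_irrefl : forall v, ~ adj v v
}.

(* Edges are unordered pairs, so each edge is counted once. *)
Definition edge_set (G : sgraph) : set (set G) :=
  [set e | exists u v : G, adj u v /\ e = [set u; v]].
Arguments edge_set : clear implicits.

Definition star (G : sgraph) (v : G) : Prop :=
  forall w : G, w <> v -> adj v w.

Definition star_free (G : sgraph) : Prop := forall v : G, ~ star v.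

Definition graph_iso (G H : sgraph) : Prop :=
  exists f : G -> H,
    bijective f /\ (forall u v : G, adj u v <-> adj (f u) (f v)).

HB.mixin Record Semigroup_hasZero S of Semigroup S := {
  szero : S;
  smul0x : left_zero szero (@mul S);
  smulx0 : right_zero szero (@mul S)
}.

#[short(type="semigroup0Type")]
HB.structure Definition Semigroup0 := {S of Semigroup_hasZero S & Semigroup S}.

Definition center (S : semigroupType) : set S :=
  [set x | forall y : S, commute x y].
Arguments center : clear implicits.

Section CommutingGraph.
Variable S : semigroupType.

Definition noncentral : Type := set_type (~` center S).

Definition comm_adj (x y : noncentral) : Prop :=
  x <> y /\ commute (val x) (val y).

Lemma comm_adj_sym x y : comm_adj x y -> comm_adj y x.
Proof. by case=> nxy cxy; split; [move=> eyx; apply: nxy|]. Qed.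

Lemma comm_adj_irrefl x : ~ comm_adj x x.
Proof. by case. Qed.

Definition commuting_graph : sgraph := SGraph comm_adj_sym comm_adj_irrefl.
End CommutingGraph.

Definition subsemigroup0 (S : semigroup0Type) (B : set S) : Prop :=
  B szero /\ (forall x y : S, B x -> B y -> B (x * y)).

Definition generates (S : semigroup0Type) (A : set S) : Prop :=
  smallest (@subsemigroup0 S) A = setT.

(* The free semigroup with zero on X: [Some (x, s)] is the nonempty word
   [x :: s], and [None] is the zero. *)
Definition word0 (X : Type) : Type := option (X * seq X).

Definition word0_mul (X : Type) (u v : word0 X) : word0 X :=
  match u, v with
  | Some (x, s), Some (y, t) => Some (x, s ++ y :: t)
  | _, _ => None
  end.

Inductive gen_congruence (X : Type) (R : word0 X -> word0 X -> Prop) :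
    word0 X -> word0 X -> Prop :=
| gen_cong_base u v : R u v -> gen_congruence R u v
| gen_cong_refl u : gen_congruence R u u
| gen_cong_sym u v : gen_congruence R u v -> gen_congruence R v u
| gen_cong_trans u v w :
    gen_congruence R u v -> gen_congruence R v w -> gen_congruence R u w
| gen_cong_mul u u' v v' :
    gen_congruence R u u' -> gen_congruence R v v' ->
    gen_congruence R (word0_mul u v) (word0_mul u' v').

(* S is <X | R> as a semigroup with zero: it is the quotient of the free
   semigroup with zero on X by the congruence generated by R. *)
Definition has_presentation (S : semigroup0Type) (X : Type)
    (R : word0 X -> word0 X -> Prop) : Prop :=
  exists f : word0 X -> S,
    [/\ f None = szero,
        forall u v, f (word0_mul u v) = f u * f v,
        forall s : S, exists u, f u = s
      & forall u v, f u = f v <-> gen_congruence R u v].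

Definition monomial (S : semigroup0Type) : Prop :=
  exists (X : Type) (R : word0 X -> word0 X -> Prop),
    (forall u v, R u v -> (exists w : X * seq X, u = Some w) /\ v = None) /\
    has_presentation S R.

(* Main.v *)
Require Import Defs.
From HB Require Import structures.
From mathcomp Require Import all_boot.
From mathcomp Require Import boolp classical_sets cardinality.
From mathcomp Require Import functions zify.

(** A set [L] of nonempty words over [X] that is closed under nonempty factors
    has an ideal as complement, and collapsing that ideal to zero turns the
    free semigroup with zero on [X] into a monomial semigroup whose elements
    are the words of [L] and a zero ([rees_monomial]).  The theorem only asks
    for a good [L] over the vertices of the graph.

    Take the letters, the words [xy] with [x] and [y] nonadjacent, and some
    powers of letters.  A word of [L] of length at least three is then a power
    of a letter, so a product with a total of three letters or more is
    insensitive to the order of its factors: everything except the letters is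
    central ([central_nonletter]).  Two distinct letters commute exactly when
    both of their products vanish, that is, when they are adjacent
    ([commute_letter]).  Finally no letter is central, because a central letter
    would be a star.  So the noncentral elements are the letters, and the
    commuting graph is the given graph.

    For the order, suppose that there are [n] vertices and [m] edges.  Words of
    length at most two give [1 + n + (n ^ 2 - 2 * m)] elements: both orders of
    the endpoints of an edge give the product zero.  The powers make up for the
    difference.  The letter [x] keeps its powers up to exponent [h x + 2], and
    except for [x] itself they are central for any [h].  If [h x] is the number
    of neighbours of [x] that precede [x] in some enumeration of the vertices,
    then [h] sums to [m], since each edge is counted at its later endpoint.  The
    order becomes [1 + n + n ^ 2 - m] ([card_graph_semigroup]). *)

Set Implicit Arguments.
Unset Strict Implicit.
Unset Printing Implicit Defensive.

Local Open Scope classical_set_scope.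
Local Open Scope card_scope.

(** * Rees quotients of free semigroups *)

(** The nonempty word [x :: s] is passed as [x] and [s], in accordance with
    the type of words [word0]. *)
Record language (X : Type) := Language {
  in_language :> X -> seq X -> Prop;
  language_factor : forall x s y t,
    in_language x (s ++ y :: t) -> in_language x s /\ in_language y t
}.

Section Rees.
Variables (X : Type) (L : language X).
Implicit Types u v w : word0 X.

Definition reduced w : Prop := if w is Some (x, s) then L x s else True.

Definition rees : Type := {w : word0 X | reduced w}.

HB.instance Definition _ := gen_eqMixin rees.
HB.instance Definition _ := gen_choiceMixin rees.

Definition reduce w : rees :=
  match pselect (reduced w) with
  | left rw => exist _ w rw
  | right _ => exist (fun w => reduced w) None I
  end.

Lemma sval_rees_inj : injective (@sval _ reduced : rees -> word0 X).
Proof.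
by move=> [u ru] [v rv] /= uv; subst v; congr exist; exact: Prop_irrelevance.
Qed.

Lemma sval_reduce w : reduced w -> sval (reduce w) = w.
Proof. by rewrite /reduce; case: pselect. Qed.

Lemma reduce_sval (a : rees) : reduce (sval a) = a.
Proof. by apply: sval_rees_inj; rewrite sval_reduce //; case: a. Qed.

Lemma reduce_nonreduced w : ~ reduced w -> reduce w = reduce None.
Proof.
by move=> nw; apply: sval_rees_inj; rewrite [RHS]sval_reduce // /reduce;
  case: pselect.
Qed.

Lemma word0_mul0 u : word0_mul u None = None.
Proof. by case: u => [[]|]. Qed.

Lemma word0_mulA : associative (@word0_mul X).
Proof. by move=> [[x s]|] [[y t]|] [[z r]|] //=; rewrite -catA. Qed.

Lemma reduced_mul u v : reduced (word0_mul u v) ->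
  word0_mul u v = None \/ reduced u /\ reduced v.
Proof.
case: u v => [[x s]|] [[y t]|] /=; try by left.
by move=> uv; right; exact: language_factor uv.
Qed.

Definition rees_mul (a b : rees) : rees :=
  reduce (word0_mul (sval a) (sval b)).

(** The words outside [L] form an ideal, so a product with a factor outside [L]
    reduces to zero before and after reduction of the factors. *)
Lemma reduce_mul u v :
  reduce (word0_mul u v) = rees_mul (reduce u) (reduce v).
Proof.
have nonreduced_mul : ~ (reduced u /\ reduced v) ->
    reduce (word0_mul u v) = reduce None.
  move=> nuv; case: (EM (reduced (word0_mul u v))) => [|/reduce_nonreduced//].
  by move=> /reduced_mul[->//|].
rewrite /rees_mul; case: (EM (reduced u)) => ru; last first.
  by rewrite nonreduced_mul ?(reduce_nonreduced ru) ?(@sval_reduce None)//;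
    case.
case: (EM (reduced v)) => rv; last first.
  by rewrite nonreduced_mul ?(reduce_nonreduced rv) ?(@sval_reduce None)
    ?word0_mul0//; case.
by rewrite !sval_reduce.
Qed.

(** [reduce] is a multiplicative surjection, so associativity descends from
    words. *)
Lemma rees_mulA : associative rees_mul.
Proof.
move=> a b c; rewrite -(reduce_sval a) -(reduce_sval b) -(reduce_sval c).
by rewrite -!reduce_mul word0_mulA.
Qed.

HB.instance Definition _ := isSemigroup.Build rees rees_mulA.

Lemma rees_mul0x : left_zero (reduce None) (@mul rees).
Proof. by move=> a; rewrite -(reduce_sval a) /mul /= -reduce_mul. Qed.

Lemma rees_mulx0 : right_zero (reduce None) (@mul rees).
Proof.
by move=> a; rewrite -(reduce_sval a) /mul /= -reduce_mul word0_mul0.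
Qed.

HB.instance Definition _ :=
  Semigroup_hasZero.Build rees rees_mul0x rees_mulx0.

(** The presentation kills exactly the words outside [L].  Every word is then
    congruent to its reduced form, whence completeness of the relations. *)
Lemma rees_monomial : monomial rees.
Proof.
pose R u v := ~ reduced u /\ v = None.
exists X, R; split.
  by move=> [w|] v [nu ->]; [split=> //; exists w | case: nu].
exists reduce; split=> //.
- by move=> u v; exact: reduce_mul.
- by move=> a; exists (sval a); exact: reduce_sval.
move=> u v; split; last first.
  elim=> {u v} [u v [nu ->]|//|u v _ <-//|u v w _ -> _ <-//|].
    exact: reduce_nonreduced.
  by move=> u u' v v' _ uu' _ vv'; rewrite !reduce_mul uu' vv'.
have cong_sval w : gen_congruence R w (sval (reduce w)).
  rewrite /reduce; case: pselect => rw; first exact: gen_cong_refl.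
  exact: gen_cong_base.
move=> uv; apply: gen_cong_trans (cong_sval u) _; rewrite uv.
exact/gen_cong_sym/cong_sval.
Qed.

Definition letter (x : X) : rees := reduce (Some (x, [::])).

Lemma letters_generate : generates (range letter).
Proof.
apply/seteqP; split=> // a _ B [[B0 BM] Bletter].
rewrite -(reduce_sval a); case: (sval a) => [[x s]|//].
elim: s x => [|y s IHs] x; first by apply: Bletter; exists x.
rewrite -[Some _]/(word0_mul (Some (x, [::])) (Some (y, s))) reduce_mul.
by apply: BM (IHs y); apply: Bletter; exists x.
Qed.

End Rees.

(** * The semigroup of a graph *)

Lemma nseq_prefix (T : Type) (x : T) s y t j : s ++ y :: t = nseq j x ->
  [/\ s = nseq (size s) x, y = x & t = nseq (size t) x].
Proof.
elim: s j => [|z s IHs] [|j] //= [].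
  by move=> -> ->; rewrite size_nseq.
by move=> -> /IHs[{1}-> -> {1}->].
Qed.

Section GraphSemigroup.
Variables (G : sgraph) (h : G -> nat).

(** Any [h] leads to the commuting graph [G]; the freedom in [h] is there to
    adjust the order.  The square of a letter is allowed by both clauses, [adj]
    being irreflexive, so the powers that [h] adds start at the cube. *)
Definition graph_word (x : G) (s : seq G) : Prop :=
  (size s <= (h x).+1 /\ s = nseq (size s) x) \/
  (exists2 y, ~ adj x y & s = [:: y]).

Lemma graph_word_factor x s y t :
  graph_word x (s ++ y :: t) -> graph_word x s /\ graph_word y t.
Proof.
case=> [[le_h E]|[z _ E]].
  have [Es Ey Et] := nseq_prefix E; subst y.
  by move: le_h; rewrite size_cat /= => le_h; split; left; split=> //; lia.
by case: s E => [[_ ->]|? []//]; split; left.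
Qed.

Definition graph_language := Language graph_word_factor.
Definition graph_semigroup : semigroup0Type := rees graph_language.

Local Notation letter := (@letter G graph_language).

Lemma letter_reduced (x : G) : reduced graph_language (Some (x, [::])).
Proof. by left. Qed.

Lemma letter_inj : injective letter.
Proof.
move=> x y /(congr1 sval).
by rewrite !sval_reduce; [case|exact: letter_reduced..].
Qed.

(** A factor with two letters forces the product to be a power of a letter,
    and then its factors are powers of the same letter. *)
Lemma reduced_mul_swap (u v : word0 G) x y s :
    u = Some (x, y :: s) \/ v = Some (x, y :: s) ->
    reduced graph_language (word0_mul u v) ->
  word0_mul u v = word0_mul v u.
Proof.
case: u v => [[a p]|] [[b q]|] //= long word.
have {word long} [j] : exists j, p ++ b :: q = nseq j a.
  case: word => [[_ E]|[c _]]; first by exists (size (p ++ b :: q)).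
  case: p long => [|? []//] [[//]|[-> ->]] //.
move=> E; have [-> -> ->] := nseq_prefix E.
have join k l : nseq k a ++ a :: nseq l a = nseq (k + l.+1) a by rewrite nseqD.
by rewrite !join addnS addnC -addnS.
Qed.

(** If either product of [a] with another element is nonzero, then both are the
    same power of a letter. *)
Lemma central_nonletter (a : graph_semigroup) :
  (forall x, a <> letter x) -> center graph_semigroup a.
Proof.
move=> nletter b; rewrite /commute /mul /= /rees_mul.
case Ea: (sval a) => [[x [|y s]]|]; last by rewrite word0_mul0.
  by case: (nletter x); rewrite /letter -Ea reduce_sval.
set u := Some _; have [uv|nuv] := EM (reduced graph_language
    (word0_mul u (sval b))).
  by congr reduce; apply: (@reduced_mul_swap _ _ x y s) => //; left.
have [vu|nvu] := EM (reduced graph_language (word0_mul (sval b) u)).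
  congr reduce; apply/esym.
  by apply: (@reduced_mul_swap _ _ x y s) => //; right.
by rewrite !reduce_nonreduced.
Qed.

(** Different letters have different words as products, so they commute only if
    both products are zero. *)
Lemma commute_letter (x y : G) :
  x <> y -> commute (letter x) (letter y) <-> adj x y.
Proof.
move=> nxy; have word_xy : forall a b : G, a <> b ->
    reduced graph_language (Some (a, [:: b])) <-> ~ adj a b.
  move=> a b nab; split=> [|ab]; last by right; exists b.
  by case=> [[_ []]/esym//|[c] + [->]].
have nyx := nesym nxy.
rewrite /commute /mul /= -!reduce_mul /=; split=> [|xy].
  apply: contraPP => nadj /(congr1 sval).
  rewrite sval_reduce; last exact/(word_xy _ _ nxy).
  rewrite sval_reduce; first by case=> /nxy.
  by apply/(word_xy _ _ nyx) => /adj_sym.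
rewrite !reduce_nonreduced //.
  by move=> /(word_xy _ _ nyx); apply; exact: adj_sym.
by move=> /(word_xy _ _ nxy); exact.
Qed.

Lemma graph_semigroup_commuting_graph :
  star_free G -> graph_iso (commuting_graph graph_semigroup) G.
Proof.
move=> sfG.
(* A central letter would be adjacent to every other vertex. *)
have letter_noncentral x : letter x \in ~` center graph_semigroup.
  apply/mem_set => cx; apply: (sfG x) => w /nesym nxw.
  exact/(commute_letter nxw)/cx.
pose g x : noncentral graph_semigroup := exist _ (letter x) (letter_noncentral x).
have g_onto (b : noncentral graph_semigroup) : exists x, g x = b.
  case: b => a na.
  have [x ax] : exists x, a = letter x.
    apply: contrapT => nletter; have /set_mem := na; apply.
    by apply: central_nonletter => x ax; apply: nletter; exists x.
  by exists x; apply: val_inj.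
have [f fK] := choice g_onto.
have gK : cancel g f.
  by move=> x; apply: letter_inj; have /(congr1 val) := fK (g x).
exists f; split; first by exists g.
move=> a b; rewrite -{1}(fK a) -{1}(fK b); split.
  case=> nab; apply: (iffLR (commute_letter _)) => // fab.
  by apply: nab; rewrite fab.
move=> ab; have nab : f a <> f b by move=> E; move: ab; rewrite E => /adj_irrefl.
split; last exact/commute_letter.
by move=> /(congr1 f); rewrite !gK.
Qed.

Lemma graph_semigroup_generators n : [set: G] #= `I_n ->
  exists A : set graph_semigroup, A #= `I_n /\ generates A.
Proof.
move=> Gn; exists (range letter); split; last exact: letters_generate.
apply: card_eq_trans Gn; apply: inj_card_eq => x y _ _; exact: letter_inj.
Qed.

End GraphSemigroup.

(** * The order of the semigroup *)

Lemma card_range_finType (T : finType) (U : Type) (f : T -> U) :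
  injective f -> range f #= `I_#|T|.
Proof.
move=> f_inj; rewrite (card_eql (inj_card_eq (in2W f_inj))) (card_eqr card_II).
have <- : range (@enum_rank T) = setT.
  by apply/seteqP; split=> // i _; exists (enum_val i); rewrite ?enum_valK.
by rewrite card_eq_sym; apply: inj_card_eq => x y _ _ /enum_rank_inj.
Qed.

Section Counting.
Variables (n : nat) (a : rel 'I_n).
Hypotheses (a_sym : symmetric a) (a_irr : irreflexive a).

Definition lower_degree (i : 'I_n) := #|[pred j : 'I_n | (j < i) && a i j]|.

Lemma sum_lower_degree :
  \sum_i lower_degree i =
  #|[pred p : 'I_n * 'I_n | (p.2 < p.1) && a p.1 p.2]|.
Proof.
rewrite -sum1_card /lower_degree.
by under eq_bigr do rewrite -sum1_card; rewrite pair_big_dep.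
Qed.

(** Every edge appears as two ordered pairs, exchanged by the swap, and the sum
    counts one of the two. *)
Lemma card_nonadjacent_pairs :
  #|[pred p : 'I_n * 'I_n | ~~ a p.1 p.2]| + (\sum_i lower_degree i).*2
  = n ^ 2.
Proof.
rewrite sum_lower_degree -addnn.
set E := [pred p : 'I_n * 'I_n | (p.2 < p.1) && a p.1 p.2].
pose E' := [pred p : 'I_n * 'I_n | (p.1 < p.2) && a p.1 p.2].
have EE' : #|E| = #|E'|.
  pose swap (p : 'I_n * 'I_n) := (p.2, p.1).
  have swapK : involutive swap by case.
  rewrite -[LHS](fintype.card_image (inv_inj swapK)); apply: eq_card => p.
  rewrite -(swapK p) fintype.mem_image; last exact: inv_inj swapK.
  by rewrite !inE /= a_sym.
have -> : #|E| + #|E| = #|[pred p : 'I_n * 'I_n | a p.1 p.2]|.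
  rewrite {1}EE' -cardUI [X in _ + X]eq_card0 ?addn0; last first.
    by move=> [i j]; rewrite !inE /=; case: ltngtP; rewrite ?andbF.
  apply: eq_card => -[i j]; rewrite !inE /=.
  by case: ltngtP => [_|_|/val_inj ->] /=; rewrite ?orbF ?a_irr.
by rewrite addnC cardC card_prod card_ord.
Qed.

End Counting.

Section Order.
Variables (G : sgraph) (n : nat) (e : G -> 'I_n) (g : 'I_n -> G).
Hypotheses (eK : cancel e g) (gK : cancel g e).

Definition edge_rel : rel 'I_n := [rel i j | `[< adj (g i) (g j) >]].

Local Notation a := edge_rel.

(** An edge is represented by the ordered pair that lists its later endpoint
    first. *)
Lemma card_edge_set : edge_set G #= `I_(\sum_i lower_degree a i).
Proof.
rewrite sum_lower_degree.
set E := [pred p : 'I_n * 'I_n | _].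
have -> : edge_set G = range (fun p : {p | E p} =>
    [set g (val p).1; g (val p).2]).
  apply/seteqP; split=> [_ [u [v [uv ->]]]|_ [[[i j] /= ij] _ <-]]; last first.
    by move: ij => /andP[_ /asboolP ij]; exists (g i), (g j).
  have : e u != e v.
    by apply/eqP => /(can_inj eK) E'; move: uv; rewrite E' => /adj_irrefl.
  rewrite neq_ltn => /orP[lt_uv|lt_vu].
    have vuE : E (e v, e u).
      by apply/andP; split=> //; apply/asboolP; rewrite !eK; exact: adj_sym.
    by exists (exist _ (e v, e u) vuE); rewrite //= !eK setUC.
  have uvE : E (e u, e v).
    by apply/andP; split=> //; apply/asboolP; rewrite !eK.
  by exists (exist _ (e u, e v) uvE); rewrite //= !eK.
rewrite -card_sig; apply: card_range_finType.
move=> [[i j] ij] [[k l] kl] /= Eset; apply: val_inj => /=.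
move: ij kl => /andP[/= ij _] /andP[/= kl _].
have : [set g k; g l] (g i) by rewrite -Eset; left.
have : [set g k; g l] (g j) by rewrite -Eset; right.
by move=> /= [] /(can_inj gK) ? [] /(can_inj gK) ?; subst i j => //; lia.
Qed.

Let h x := lower_degree a (e x).

(** The powers beyond the square that [h] adds restore one element for each
    edge, out of the two pairs that the edge removes. *)
Lemma card_graph_semigroup m : edge_set G #= `I_m ->
  [set: graph_semigroup h] #= `I_(n ^ 2 + n + 1 - m).
Proof.
(* The zero, the letters, the pairs, and the powers with exponent at least
   three. *)
pose T := option ('I_n + {p : 'I_n * 'I_n | ~~ a p.1 p.2} +
                  {i : 'I_n & 'I_(lower_degree a i)}).
pose word (t : T) : word0 G := match t with
  | None => None
  | Some (inl (inl i)) => Some (g i, [::])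
  | Some (inl (inr p)) => Some (g (val p).1, [:: g (val p).2])
  | Some (inr k) => Some (g (tag k), nseq (tagged k).+2 (g (tag k)))
  end.
have word_inj : injective word.
  move=> [[[i|[[i j] nij]]|[i k]]|] [[[i'|[[i' j'] nij']]|[i' k']]|] //=.
  - by case=> /(can_inj gK) ->.
  - case=> /(can_inj gK) ? /(can_inj gK) ?; subst i' j'.
    by congr (Some (inl (inr _))); apply: val_inj.
  - case=> /(can_inj gK) ?; subst i' => _ _ /(congr1 size); rewrite !size_nseq.
    by move=> /val_inj ->.
have range_word : range word = reduced (graph_language h).
  apply/seteqP; split=> [_ [t _ <-]|[[x s]|_]]; last by exists None.
    case: t => [[[i|[[i j] /= nij]]|[i k]]|] //=; first by left.
      by right; exists (g j) => //; exact: (asboolPn _ nij).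
    left; rewrite /= !size_nseq; split=> //.
    by rewrite /h gK; have := ltn_ord k.
  have nonadj_word y : ~ adj x y -> range word (Some (x, [:: y])).
    move=> nxy; have nij : ~~ a (e x, e y).1 (e x, e y).2.
      by apply/asboolPn; rewrite /= !eK.
    by exists (Some (inl (inr (exist _ (e x, e y) nij)))); rewrite //= !eK.
  case=> [[le_h ->]|[y nxy ->]]; last exact: nonadj_word.
  case: (size s) le_h => [|[|k]].
  - by exists (Some (inl (inl (e x)))); rewrite //= eK.
  - by move=> _; exact/nonadj_word/adj_irrefl.
  - rewrite ltnS => lt_k; exists (Some (inr (Tagged
      (fun i => 'I_(lower_degree a i)) (Ordinal lt_k)))) => //.
    by rewrite /= !eK.
move=> Em; have m_sum : m = \sum_i lower_degree a i.
  by apply/card_eq_II; rewrite -(card_eql Em); exact: card_edge_set.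
have T_card : #|{: T}| = n ^ 2 + n + 1 - m.
  have a_sym : symmetric a.
    by move=> i j; apply/asbool_equiv_eq; split; exact: adj_sym.
  have a_irr : irreflexive a by move=> i; apply/asboolPn/adj_irrefl.
  rewrite card_option !card_sum card_ord card_sig card_tagged.
  rewrite sumnE big_map big_enum /=.
  under eq_bigr do rewrite card_ord.
  by have := card_nonadjacent_pairs a_sym a_irr; rewrite -m_sum; lia.
rewrite -T_card -(card_eqr (card_range_finType word_inj)) range_word.
have <- : range (@sval _ (reduced (graph_language h))) =
    reduced (graph_language h).
  apply/seteqP; split=> [_ [[w rw] _ <-]//|w rw].
  by exists (exist _ w rw).
rewrite card_eq_sym; apply: inj_card_eq => u v _ _; exact: sval_rees_inj.
Qed.

End Order.

Theorem proposition3 (G : sgraph) (hG : star_free G) :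
  (exists S : semigroup0Type,
     monomial S /\ graph_iso (commuting_graph S) G) /\
  (forall n m : nat,
     [set: G] #= `I_n -> edge_set G #= `I_m ->
     exists S : semigroup0Type,
       [/\ monomial S,
           graph_iso (commuting_graph S) G,
           exists A : set S, A #= `I_n /\ generates A
         & [set: S] #= `I_(n ^ 2 + n + 1 - m)]).
Proof.
split.
  exists (graph_semigroup (fun _ : G => 0)).
  by split; [exact: rees_monomial | exact: graph_semigroup_commuting_graph].
move=> n m Gn Em.
have [e [g eK gK]] : exists e : G -> 'I_n, bijective e.
  move: (Gn); rewrite (card_eqr card_II) => /card_bijP[e [g eK gK]].
  exists (val \o e \o to_setT); exists (val \o g \o to_setT) => x /=.
    by rewrite (_ : to_setT _ = e (to_setT x)) ?eK //; exact: val_inj.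
  by rewrite (_ : to_setT _ = g (to_setT x)) ?gK //; exact: val_inj.
exists (graph_semigroup (fun x => lower_degree (edge_rel g) (e x))).
split; first exact: rees_monomial.
- exact: graph_semigroup_commuting_graph.
- exact: graph_semigroup_generators.
- exact: card_graph_semigroup.
Qed.
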